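(* Let $m\ge1$, $n\geq 0$, and let $a,A$ be nonzero real numbers. Then the map $$v:\mathrm{H}^{m+1}(a)\to\mathrm{H}^{n+1}(A),\qquad v(x,\boldsymbol{y})=(x,\boldsymbol{0}),$$ is biharmonic but not harmonic.
   Context: $\mathrm{H}^{m+1}(a)$ is the half-space with coordinates $(x,\boldsymbol{y})$, $x\ge 0$, $\boldsymbol{y}\in\mathbb{R}^m$, with metric (on $x>0$) $g=a^{-2}\frac{dx^2+d\boldsymbol{y}^2}{x^2}$; $\mathrm{H}^{n+1}(A)$ is the half-space with coordinates $(X,\boldsymbol{Y})$, $X\ge0$, $\boldsymbol{Y}\in\mathbb{R}^n$, with metric (on $X>0$) $h=A^{-2}\frac{dX^2+d\boldsymbol{Y}^2}{X^2}$. Harmonicity and biharmonicity are considered on the interior $\{x>0\}$: the tension field is $\tau(v)=\operatorname{tr}_g\nabla dv$, where $\nabla$ is induced by the Levi-Civita connection of $g$ and the pull-back of the Levi-Civita connection $\nabla^h$ of $h$. The Jacobi operator is $J_v=\Delta+\operatorname{tr}_gR_h(dv,\cdot)dv$ on sections of the pull-back of the tangent bundle, with $\Delta=(v^*\nabla^h)^*(v^*\nabla^h)$ the (positive) rough Laplacian and $R_h$ the Riemann tensor, with sign such that $\langle R_h(\xi,w)\xi,w\rangle$ equals minus the sectional curvature for orthonormal $\xi,w$. $v$ is harmonic if $\tau(v)=0$ and biharmonic if $J_v(\tau(v))=0$. *)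

(* Defs.v *)
From HB Require Import structures.
From mathcomp Require Import all_boot all_order all_algebra.
From mathcomp Require Import all_classical all_reals all_analysis.
From mathcomp Require Import ring.

Set Implicit Arguments.
Unset Strict Implicit.
Unset Printing Implicit Defensive.

Import Order.TTheory GRing.Theory Num.Theory.
Import numFieldNormedType.Exports.
Local Open Scope classical_set_scope.
Local Open Scope ring_scope.

(* Everything is written in the global coordinates of an open subset of R^d,
   d >= 1. A point and a tangent vector are row vectors, coordinate 0 being
   the first one; a Riemannian metric is the field of its Gram matrices in the
   coordinate frame. *)

Section RiemannianGeometry.
Variables (R : realType) (d : nat).
Notation E := 'rV[R]_d.+1.

Definition pd (V : normedModType R) (i : 'I_d.+1) (f : E -> V) (p : E) : V :=
  'D_(delta_mx 0 i) f p.

(* C^infty on an open set U: every iterated partial derivative is (Frechet)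
   differentiable at every point of U. *)
Definition smooth_on (V : normedModType R) (U : set E) (f : E -> V) : Prop :=
  forall (s : seq 'I_d.+1) (p : E), U p -> differentiable (foldr (@pd V) f s) p.

Variable G : E -> 'M[R]_d.+1.

Definition inner (p : E) (u w : E) : R := (u *m G p *m w^T) 0 0.

Definition trace (V : lmodType R) (p : E) (B : 'I_d.+1 -> 'I_d.+1 -> V) : V :=
  \sum_i \sum_j invmx (G p) i j *: B i j.

(* [christoffel p k i j] is Gamma^k_ij, where nabla_i d_j = Gamma^k_ij d_k. *)
Definition christoffel (p : E) (k i j : 'I_d.+1) : R :=
  2^-1 * \sum_l invmx (G p) k l *
    (pd i (fun q => G q j l) p + pd j (fun q => G q i l) p
     - pd l (fun q => G q i j) p).

(* R(u,w)z = nabla_u nabla_w z - nabla_w nabla_u z - nabla_[u,w] z; with this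
   sign <R(u,w)u,w> is minus the sectional curvature for u, w orthonormal. *)
Definition riemann (p : E) (u w z : E) : E :=
  \row_l \sum_i \sum_j \sum_k u 0 i * w 0 j * z 0 k *
    (pd i (fun q => christoffel q l j k) p
     - pd j (fun q => christoffel q l i k) p
     + \sum_s (christoffel p l i s * christoffel p s j k
               - christoffel p l j s * christoffel p s i k)).

End RiemannianGeometry.

(* The Christoffel symbols are the unique symmetric (torsion-free) connection
   coefficients compatible with the metric. *)
Section LeviCivita.
Variables (R : realType) (d : nat) (G : 'rV[R]_d.+1 -> 'M[R]_d.+1).
Hypothesis Gsym : forall q, (G q)^T = G q.

Let GC q i j : G q i j = G q j i.
Proof. by rewrite -[in LHS]Gsym mxE. Qed.

Let dGC p k i j :
  pd k (fun q => G q i j) p = pd k (fun q => G q j i) p.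
Proof. by rewrite (_ : (fun q => G q i j) = fun q => G q j i)//; apply/funext. Qed.

Lemma christoffel_sym p k i j : christoffel G p k i j = christoffel G p k j i.
Proof.
rewrite /christoffel; congr (_ * _); apply: eq_bigr => l _; congr (_ * _).
by rewrite (dGC p l i j) [X in X - _]addrC.
Qed.

Let mxE0 l s : (1%:M : 'M[R]_d.+1) l s = (l == s)%:R.
Proof. by rewrite !mxE. Qed.

Let GV p l s : G p \in unitmx ->
  \sum_k G p l k * invmx (G p) k s = (l == s)%:R.
Proof. by move=> Gp; rewrite -(mxE0 l s) -(mulmxV Gp) mxE. Qed.

Let lower p (Gp : G p \in unitmx) l i j :
  \sum_k christoffel G p k i j * G p k l =
  2^-1 * (pd i (fun q => G q j l) p + pd j (fun q => G q i l) p
     - pd l (fun q => G q i j) p).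
Proof.
set D := fun l => pd i (fun q => G q j l) p + pd j (fun q => G q i l) p
     - pd l (fun q => G q i j) p.
rewrite /christoffel.
transitivity (2^-1 * \sum_s (\sum_k G p l k * invmx (G p) k s) * D s).
  rewrite mulr_sumr.
  under eq_bigr do rewrite -mulrA mulr_suml mulr_sumr.
  rewrite exchange_big; apply: eq_bigr => s _.
  rewrite mulr_suml mulr_sumr; apply: eq_bigr => k _.
  by rewrite (GC p k l) /D; ring.
congr (_ * _); rewrite (bigD1 l)//= GV// eqxx mul1r big1 ?addr0// => s sl.
by rewrite GV// eq_sym (negPf sl) mul0r.
Qed.

Lemma christoffel_metric p k i j : G p \in unitmx ->
  pd k (fun q => G q i j) p =
  \sum_l (christoffel G p l k i * G p l j + christoffel G p l k j * G p i l).
Proof.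
move=> Gp; rewrite big_split/= (lower Gp).
under [X in _ + X]eq_bigr do rewrite (GC p i).
rewrite (lower Gp) (dGC p k j i) (dGC p j k i) (dGC p i k j).
by field.
Qed.

Lemma christoffel_uniq p (C : 'I_d.+1 -> 'I_d.+1 -> 'I_d.+1 -> R) :
  G p \in unitmx -> (forall k i j, C k i j = C k j i) ->
  (forall k i j, pd k (fun q => G q i j) p =
    \sum_l (C l k i * G p l j + C l k j * G p i l)) ->
  forall k i j, C k i j = christoffel G p k i j.
Proof.
move=> Gp Csym Cmet k i j.
pose S i j l := \sum_k C k i j * G p k l.
have Ssym a b l : S a b l = S b a l by apply: eq_bigr => s _; rewrite Csym.
have Smet c a b : pd c (fun q => G q a b) p = S c a b + S c b a.
  rewrite Cmet big_split; congr (_ + _); apply: eq_bigr => s _.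
  by rewrite (GC p a).
have low l : S i j l = \sum_k christoffel G p k i j * G p k l.
  rewrite (lower Gp) !Smet (Ssym l i) (Ssym l j) (Ssym j i).
  by field.
have : (\row_k C k i j) *m G p = (\row_k christoffel G p k i j) *m G p.
  apply/rowP => l; rewrite !mxE.
  under eq_bigr do rewrite mxE; under [RHS]eq_bigr do rewrite mxE.
  exact: low.
move/(can_inj (mulmxK Gp))/rowP/(_ k); by rewrite !mxE.
Qed.
End LeviCivita.

Section MapGeometry.
Variables (R : realType) (d e : nat).
Notation E := 'rV[R]_d.+1.
Notation F := 'rV[R]_e.+1.

(* A section of v^*TN is given by its components in the coordinate frame of N;
   a 1-form with values in v^*TN by its values on the coordinate frame of M. *)
Notation vsection := (E -> F).
Notation vform := ('I_d.+1 -> E -> F).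

Variables (G : E -> 'M[R]_d.+1) (H : F -> 'M[R]_e.+1) (v : E -> F).

Definition dmap : vform := fun j => pd j v.

Definition nabla (W : vsection) : vform := fun i p =>
  pd i W p + \row_k \sum_a \sum_b
    christoffel H (v p) k a b * dmap i p 0 a * W p 0 b.

(* [nabla_form w i j] is (nabla_i w)(d_j), for the connection induced by the
   Levi-Civita connection of G and the pull-back connection. *)
Definition nabla_form (w : vform) (i j : 'I_d.+1) (p : E) : F :=
  nabla (w j) i p - \sum_k christoffel G p k i j *: w k p.

Definition tension : vsection := fun p =>
  trace G p (fun i j => nabla_form dmap i j p).

(* The formal L^2-adjoint of [nabla] is -tr nabla, see [nabla_adjointP]. *)
Definition nabla_adjoint (w : vform) : vsection := fun p =>
  - trace G p (fun i j => nabla_form w i j p).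

Definition rough_laplacian (W : vsection) : vsection :=
  nabla_adjoint (nabla W).

Definition jacobi (W : vsection) : vsection := fun p =>
  rough_laplacian W p
  + trace G p (fun i j => riemann H (v p) (dmap i p) (W p) (dmap j p)).

Definition harmonic_on (M : set E) : Prop :=
  forall p, M p -> tension p = 0.

Definition biharmonic_on (M : set E) : Prop :=
  forall p, M p -> jacobi tension p = 0.

End MapGeometry.

Section FormalAdjoint.
Variables (R : realType) (d e : nat).
Variables (G : 'rV[R]_d.+1 -> 'M[R]_d.+1) (H : 'rV[R]_e.+1 -> 'M[R]_e.+1)
  (v : 'rV[R]_d.+1 -> 'rV[R]_e.+1).
Hypothesis Hsym : forall q, (H q)^T = H q.

Lemma innerE d' (K : 'rV[R]_d'.+1 -> 'M[R]_d'.+1) q u w :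
  inner K q u w = \sum_a \sum_b K q a b * u 0 a * w 0 b.
Proof.
rewrite /inner mxE exchange_big; apply: eq_bigr => b _.
rewrite !mxE mulr_suml; by apply: eq_bigr => a _; ring.
Qed.

Let pdE i (W : 'rV[R]_d.+1 -> 'rV[R]_e.+1) p a : differentiable W p ->
  is_derive p (delta_mx 0 i) (fun q => W q 0 a) (pd i W p 0 a).
Proof.
move=> dW; have dv : derivable W p (delta_mx 0 i) by exact: diff_derivable.
have /derivable_mxP dv' := dv.
by apply: DeriveDef; rewrite // /pd derive_mx// mxE.
Qed.

Let chain i p (f : 'rV[R]_e.+1 -> R) : differentiable v p ->
  differentiable f (v p) ->
  is_derive p (delta_mx 0 i) (f \o v)
    (\sum_c pd i v p 0 c * pd c f (v p)).
Proof.
move=> dv df; have dfv : differentiable (f \o v) p by exact: differentiable_comp.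
apply: DeriveDef; first exact: diff_derivable.
rewrite deriveE// diff_comp//= /pd [in RHS]deriveE//.
set u := 'd v p _; rewrite [u in LHS]row_sum_delta linear_sum.
by apply: eq_bigr => c _; rewrite linearZ/= deriveE.
Qed.

Lemma nabla_metric (W Z : 'rV[R]_d.+1 -> 'rV[R]_e.+1) i p :
  H (v p) \in unitmx -> (forall a b, differentiable (fun q => H q a b) (v p)) ->
  differentiable v p -> differentiable W p -> differentiable Z p ->
  pd i (fun q => inner H (v q) (W q) (Z q)) p =
    inner H (v p) (nabla H v W i p) (Z p) + inner H (v p) (W p) (nabla H v Z i p).
Proof.
move=> Hu dH dv dW dZ.
have -> : (fun q => inner H (v q) (W q) (Z q)) = \sum_a \sum_b
   (((fun q => H q a b) \o v) * (fun q => W q 0 a) * (fun q => Z q 0 b)).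
  apply/funext => q; rewrite innerE fct_sumE; apply: eq_bigr => a _.
  by rewrite fct_sumE.
have HD a b : is_derive p (delta_mx 0 i)
   (((fun q => H q a b) \o v) * (fun q => W q 0 a) * (fun q => Z q 0 b))
   (H (v p) a b * W p 0 a * pd i Z p 0 b + Z p 0 b *
      (H (v p) a b * pd i W p 0 a + W p 0 a *
        \sum_c pd i v p 0 c * pd c (fun q => H q a b) (v p))).
  have ? := pdE i a dW; have ? := pdE i b dZ.
  have ? := chain i dv (dH a b).
  by apply: is_derive_eq.
rewrite /pd (@derive_val _ _ _ _ _ _ _ (is_derive_sum (fun a => is_derive_sum (HD a)))).
rewrite !innerE.
under eq_bigr => a _ do under eq_bigr => b _ do
  under eq_bigr => c _ do rewrite (christoffel_metric Hsym)// big_split/=.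
pose P := \sum_a \sum_b H (v p) a b * pd i W p 0 a * Z p 0 b.
pose Q := \sum_a \sum_b H (v p) a b * W p 0 a * pd i Z p 0 b.
pose S := \sum_a \sum_b \sum_c \sum_l
   Z p 0 b * W p 0 a * pd i v p 0 c * christoffel H (v p) l c a * H (v p) l b.
pose T := \sum_a \sum_b \sum_c \sum_l
   Z p 0 b * W p 0 a * pd i v p 0 c * christoffel H (v p) l c b * H (v p) a l.
transitivity (Q + P + S + T).
  rewrite /P /Q /S /T -!big_split; apply: eq_bigr => a _.
  rewrite -!big_split; apply: eq_bigr => b _ /=.
  rewrite -!addrA; congr (_ + _).
  rewrite mulrDr; congr (_ + _); first by ring.
  rewrite -big_split !mulr_sumr; apply: eq_bigr => c _ /=.
  rewrite -!big_split !mulr_sumr; apply: eq_bigr => l _ /=.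
  by ring.
rewrite [Q + P]addrC -addrA addrACA.
congr (_ + _); last rewrite addrC.
- transitivity (P + \sum_a \sum_b \sum_c \sum_s H (v p) a b * Z p 0 b *
    (christoffel H (v p) a c s * pd i v p 0 c * W p 0 s)).
    congr (_ + _); rewrite /S exchange_big [RHS]exchange_big/=.
    apply: eq_bigr => b _; rewrite exchange_big [RHS]exchange_big/=.
    apply: eq_bigr => c _; rewrite exchange_big/=.
    by apply: eq_bigr => l _; apply: eq_bigr => a _; ring.
  rewrite /P -big_split; apply: eq_bigr => a _; rewrite -big_split.
  apply: eq_bigr => b _ /=; rewrite !mxE mulrDr mulrDl; congr (_ + _).
  rewrite mulr_sumr mulr_suml; apply: eq_bigr => c _.
  rewrite mulr_sumr mulr_suml; apply: eq_bigr => l _.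
  by rewrite /dmap; ring.
- transitivity (\sum_a \sum_b \sum_c \sum_s H (v p) a b * W p 0 a *
    (christoffel H (v p) b c s * pd i v p 0 c * Z p 0 s) + Q).
    congr (_ + _); rewrite /T.
    apply: eq_bigr => a _; rewrite exchange_big [RHS]exchange_big/=.
    apply: eq_bigr => c _; rewrite exchange_big/=.
    by rewrite exchange_big/= exchange_big/=; apply: eq_bigr => l _;
      apply: eq_bigr => b _; ring.
  rewrite addrC /Q -big_split; apply: eq_bigr => a _; rewrite -big_split.
  apply: eq_bigr => b _ /=; rewrite !mxE mulrDr; congr (_ + _).
  rewrite mulr_sumr; apply: eq_bigr => c _.
  rewrite mulr_sumr; apply: eq_bigr => l _.
  by rewrite /dmap; ring.
Qed.

Let innerDl q (u u' w : 'rV[R]_e.+1) :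
  inner H q (u + u') w = inner H q u w + inner H q u' w.
Proof. by rewrite /inner !mulmxDl mxE. Qed.

Let innerZl q c (u w : 'rV[R]_e.+1) : inner H q (c *: u) w = c * inner H q u w.
Proof. by rewrite /inner -!scalemxAl mxE. Qed.

Let innerNl q (u w : 'rV[R]_e.+1) : inner H q (- u) w = - inner H q u w.
Proof. by rewrite /inner !mulNmx mxE. Qed.

Let inner_suml q n (u : 'I_n -> 'rV[R]_e.+1) w :
  inner H q (\sum_i u i) w = \sum_i inner H q (u i) w.
Proof.
by rewrite /inner !mulmx_suml summxE.
Qed.

(* Pointwise Green identity: the last trace is the divergence of the vector
   field dual to the 1-form theta, so for Z compactly supported it integrates
   to 0 against the Riemannian volume, leaving
   int <nabla_adjoint w, Z> = int <w, nabla Z>. *)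
Lemma nabla_adjointP (w : 'I_d.+1 -> 'rV[R]_d.+1 -> 'rV[R]_e.+1)
    (Z : 'rV[R]_d.+1 -> 'rV[R]_e.+1) p
    (theta := fun i q => inner H (v q) (w i q) (Z q)) :
  H (v p) \in unitmx -> (forall a b, differentiable (fun q => H q a b) (v p)) ->
  differentiable v p -> (forall i, differentiable (w i) p) ->
  differentiable Z p ->
  inner H (v p) (nabla_adjoint G H v w p) (Z p) =
    trace G p (fun i j => inner H (v p) (w j p) (nabla H v Z i p) : R^o)
    - trace G p (fun i j => (pd i (theta j) p
        - \sum_k christoffel G p k i j * theta k p) : R^o).
Proof.
move=> Hu dH dv dw dZ; rewrite /nabla_adjoint /trace innerNl inner_suml.
rewrite -sumrB -sumrN; apply: eq_bigr => i _; rewrite inner_suml -sumrB -sumrN.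
apply: eq_bigr => j _; rewrite innerZl /nabla_form innerDl innerNl inner_suml.
rewrite /theta nabla_metric//.
under eq_bigr do rewrite innerZl.
rewrite /GRing.scale/=; ring.
Qed.
End FormalAdjoint.

Section HalfSpace.
Variable R : realType.

(* Coordinate 0 is x; the remaining d coordinates are y. *)
Definition half_space (d : nat) : set 'rV[R]_d.+1 := [set p | 0 <= p 0 0].

Definition half_space_int (d : nat) : set 'rV[R]_d.+1 := [set p | 0 < p 0 0].

Definition half_space_metric (d : nat) (a : R) (p : 'rV[R]_d.+1) : 'M[R]_d.+1 :=
  (a ^- 2 / p 0 0 ^+ 2)%:M.

Definition axis_map (m n : nat) (p : 'rV[R]_m.+1) : 'rV[R]_n.+1 :=
  \row_j (if j == 0 then p 0 0 else 0).

End HalfSpace.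

(* Main.v *)
(* The Levi-Civita coefficients of both half-spaces give
   tension v = - m a^2 x d_X, which does not vanish. This field is parallel
   along v: the coefficient Gamma^0_00 = - 1 / X cancels the derivative of x,
   and v does not depend on y. So the rough Laplacian of the tension is zero;
   the curvature term is zero too, as dv(d_i) and the tension are collinear. *)

Require Import Defs.
From mathcomp Require Import all_boot all_order all_algebra.
From mathcomp Require Import all_classical all_reals all_analysis.
From mathcomp Require Import ring.
Import Order.TTheory GRing.Theory Num.Theory.
Import numFieldNormedType.Exports.
Local Open Scope classical_set_scope.
Local Open Scope ring_scope.

Section Coordinate.
Variables (R : realType) (d : nat).
Notation E := 'rV[R]_d.+1.
Implicit Types (p : E) (i j k : 'I_d.+1).

Lemma is_derive_coord0 p i :
  is_derive p (delta_mx 0 i : E) (fun q : E => q 0 0) (i == 0)%:R.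
Proof.
apply: DeriveDef; first exact/diff_derivable/differentiable_coord.
(* The identity has the direction itself as derivative; entry (0,0) of this matrix equation is the
   claim. *)
have /matrixP/(_ 0 0) : 'D_(delta_mx 0 i) (@id E) p = delta_mx 0 i.
  exact: derive_val.
rewrite derive_mx ?mxE; last exact: derivable_id.
by rewrite eqxx/= eq_sym.
Qed.

Lemma pd_coord0Z (V : normedModType R) (u : V) i p :
  pd i (fun q : E => q 0 0 *: u) p = (i == 0)%:R *: u.
Proof.
have dc : differentiable (fun q : E => q 0 0) p by exact: differentiable_coord.
rewrite /pd deriveE; last exact: differentiableZl.
rewrite diffZl//= -deriveE//.
by rewrite (@derive_val _ _ _ _ _ _ _ (is_derive_coord0 p i)).
Qed.

(** The function is linear, so one partial derivative makes it constant and all later ones stay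
    constant. *)
Lemma smooth_on_coord0Z (V : normedModType R) (u : V) (U : set E) :
  smooth_on U (fun q : E => q 0 0 *: u).
Proof.
move=> s p _; suff [->|[c ->]] :
    foldr (@pd R d V) (fun q => q 0 0 *: u) s = (fun q => q 0 0 *: u) \/
    exists c, foldr (@pd R d V) (fun q => q 0 0 *: u) s = cst c.
  - exact/differentiableZl/differentiable_coord.
  - exact: differentiable_cst.
elim: s => [|i s IH]/=; first by left.
right; case: IH => [->|[c ->]].
  by exists ((i == 0)%:R *: u); apply/funext => q; rewrite pd_coord0Z.
by exists 0; apply/funext => q; rewrite /pd derive_cst.
Qed.

(** Openness of the interior: a formula valid only where x > 0 may be substituted under a derivative
    at such a point. *)
Lemma near_half_space_int p : half_space_int p -> \near p, half_space_int p.
Proof.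
rewrite /half_space_int/= => p0.
exact: (@coord_continuous R 1 d.+1 0 0 p _ (lt_nbhsr p0)).
Qed.

Lemma pd_half_space_metric (a : R) p i j k : 0 < p 0 0 ->
  pd k (fun q => half_space_metric a q i j) p =
  - 2 * a ^- 2 / p 0 0 ^+ 3 * ((k == 0) && (i == j))%:R.
Proof.
move=> p0; have pn0 : p 0 0 != 0 by rewrite gt_eqF.
have D : is_derive p (delta_mx 0 k) (fun q : E => q 0 0 ^+ 2)
    (2 * p 0 0 * (k == 0)%:R).
  have := is_deriveX 2 (is_derive_coord0 p k).
  by rewrite exprfctE.
have -> : (fun q => half_space_metric a q i j) =
   (a ^- 2 *+ (i == j)) *: (fun q : E => (q 0 0 ^+ 2)^-1).
  by apply/funext => q; rewrite !mxE -mulrnAl.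
have [dD vD] := D.
have p2 : p 0 0 ^+ 2 != 0 by rewrite expf_eq0.
rewrite /pd deriveZ; last
  exact: (@derivableV _ _ (fun q : E => q 0 0 ^+ 2) p _ p2 dD).
rewrite (@deriveV _ _ (fun q : E => q 0 0 ^+ 2) p _ p2 dD) vD /GRing.scale/=.
set c := a ^- 2.
case: (k == 0); case: (i == j) => /=; rewrite ?mulr0n ?mulr1n; by field.
Qed.

(** The inverse metric is scalar, so only l = k survives in the sum; its factor a^2 cancels the a^-2
    of the metric, and the symbols are independent of [a]. *)
Lemma christoffel_half_space_metric (a : R) p k i j : a != 0 -> 0 < p 0 0 ->
  christoffel (half_space_metric a) p k i j =
  (((k == 0) && (i == j))%:R - ((i == 0) && (j == k))%:R
    - ((j == 0) && (i == k))%:R) / p 0 0.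
Proof.
move=> a0 p0; have pn0 : p 0 0 != 0 by rewrite gt_eqF.
rewrite /christoffel (bigD1 k)//= big1 ?addr0 => [|l lk]; last first.
  by rewrite invmx_scalar mxE eq_sym (negPf lk) mul0r.
rewrite invmx_scalar mxE eqxx mulr1n invfM !invrK !pd_half_space_metric//.
set b1 := _%:R; set b2 := _%:R; set b3 := _%:R.
by field; rewrite pn0 a0.
Qed.
End Coordinate.

Lemma trace_half_space_metric (R : realType) (d : nat) (V : lmodType R) (a : R)
    (p : 'rV[R]_d.+1) (B : 'I_d.+1 -> 'I_d.+1 -> V) :
  trace (half_space_metric a) p B = (a ^+ 2 * p 0 0 ^+ 2) *: \sum_i B i i.
Proof.
rewrite scaler_sumr; apply: eq_bigr => i _; rewrite (bigD1 i)//= big1 ?addr0.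
  (* With 0^-1 = 0, inversion is an involution on all of [R], so this covers every [p]. *)
  by rewrite invmx_scalar mxE eqxx mulr1n invfM invrK invrK.
by move=> j ji; rewrite invmx_scalar mxE eq_sym (negPf ji) scale0r.
Qed.

Lemma riemann_collinear (R : realType) (d : nat) (G : 'rV[R]_d.+1 -> 'M[R]_d.+1)
    (p u z : 'rV[R]_d.+1) (b c : R) :
  riemann G p (b *: u) (c *: u) z = 0.
Proof.
(* Each component is shown equal to its opposite: swapping i and j flips the sign of the curvature
   coefficient but fixes the product of the two collinear vectors' components. *)
apply/rowP => l; rewrite !mxE; apply/eqP; rewrite -eqNr; apply/eqP.
rewrite [in RHS]exchange_big -sumrN; apply: eq_bigr => i _.
rewrite -sumrN; apply: eq_bigr => j _; rewrite -sumrN; apply: eq_bigr => k _.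
rewrite !sumrB !mxE; ring.
Qed.

Section AxisMap.
Variables (R : realType) (m n : nat) (a A : R).
Hypotheses (a0 : a != 0) (A0 : A != 0).
Notation E := 'rV[R]_m.+1.
Notation F := 'rV[R]_n.+1.
Notation v := (@axis_map R m n).
Notation g := (@half_space_metric R m a).
Notation h := (@half_space_metric R n A).
Notation e0 := (delta_mx 0 0 : F).
Implicit Types (p : E) (i j k : 'I_m.+1).

Lemma axis_mapE : v = fun p => p 0 0 *: e0.
Proof.
apply/funext => p; apply/rowP => j; rewrite !mxE eqxx/=.
by case: eqP => _; rewrite ?mulr1 ?mulr0.
Qed.

Lemma axis_map00 p : v p 0 0 = p 0 0.
Proof. by rewrite mxE. Qed.

Lemma dmap_axis_map i p : dmap v i p = (i == 0)%:R *: e0.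
Proof. by rewrite /dmap axis_mapE pd_coord0Z. Qed.

(** Both dv(d_i) and [W p] lie along [e0], so only the target symbols Gamma^k_00 enter: -1/X for k =
    0, zero otherwise. This term sees [W] only at [p], hence the pointwise hypothesis. *)
Lemma nabla_axis_map (W : E -> F) (w : R) i p : half_space_int p ->
  W p = w *: e0 ->
  nabla h v W i p = pd i W p - ((i == 0)%:R * w / p 0 0) *: e0.
Proof.
move=> p0 Wp; congr (_ + _); apply/rowP => k; rewrite !mxE.
have vp0 : 0 < v p 0 0 by rewrite axis_map00.
rewrite (bigD1 0)//= [X in _ + X]big1 ?addr0 => [|b b0]; last first.
  by apply: big1 => c _; rewrite dmap_axis_map !mxE (negPf b0) !(mulr0, mul0r).
rewrite (bigD1 0)//= big1 ?addr0 => [|b b0]; last first.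
  by rewrite Wp !mxE (negPf b0) !(mulr0, mul0r).
rewrite Wp dmap_axis_map !mxE christoffel_half_space_metric// axis_map00 eqxx.
rewrite !andbT (eq_sym 0 k) !mulr1 andTb; ring.
Qed.

(** Second fundamental form of [v]. Target and domain contributions cancel at i = j = 0, as x-lines
    go to geodesics isometrically up to scale; only the y-directions remain, through the domain
    symbol Gamma^0_ii = 1/x. *)
Lemma nabla_form_dmap i j p : half_space_int p ->
  nabla_form g h v (dmap v) i j p =
  ((((i == 0) && (j == 0))%:R - (i == j)%:R) / p 0 0) *: e0.
Proof.
move=> p0.
rewrite /nabla_form (nabla_axis_map _ _ _ _ p0 (dmap_axis_map j p)).
have -> : dmap v j = cst ((j == 0)%:R *: e0).
  by apply/funext => q; rewrite dmap_axis_map.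
rewrite /pd derive_cst sub0r (bigD1 0)//= big1 ?addr0 => [|k k0]; last first.
  by rewrite dmap_axis_map (negPf k0) scale0r scaler0.
rewrite dmap_axis_map eqxx scale1r -scaleNr -scalerBl; congr (_ *: _).
rewrite christoffel_half_space_metric// eqxx andTb (andbC (j == 0)).
by rewrite -mulnb natrM; ring.
Qed.

Lemma tension_axis_map p : half_space_int p ->
  tension g h v p = p 0 0 *: (- m%:R * a ^+ 2 *: e0).
Proof.
move=> p0; have pn0 : p 0 0 != 0 by rewrite gt_eqF.
rewrite /tension trace_half_space_metric.
under eq_bigr do rewrite nabla_form_dmap// andbb eqxx.
(* The x-direction contributes nothing; each of the [m] y-directions gives -1/x. *)
rewrite -scaler_suml big_ord_recl/= subrr mul0r add0r.
rewrite (eq_bigr (fun=> - (p 0 0)^-1)) => [|i _]; last by rewrite sub0r mulN1r.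
rewrite sumr_const card_ord !scalerA; congr (_ *: _).
rewrite -mulr_natl; by field.
Qed.

Lemma nabla_tension i p : half_space_int p ->
  nabla h v (tension g h v) i p = 0.
Proof.
move=> p0; have pn0 : p 0 0 != 0 by rewrite gt_eqF.
rewrite (nabla_axis_map _ (p 0 0 * (- m%:R * a ^+ 2)))//; last first.
  by rewrite tension_axis_map// scalerA.
(* The closed form of the tension holds near [p], which allows differentiating it. *)
rewrite /pd (@near_eq_derive _ _ _ _
  (fun q : E => q 0 0 *: (- m%:R * a ^+ 2 *: e0))).
  rewrite -/(pd _ _ _) pd_coord0Z scalerA -scalerBl.
  by rewrite [X in X *: _](_ : _ = 0) ?scale0r//; field.
by near=> q; apply: tension_axis_map; near: q; exact: near_half_space_int.
Unshelve. all: by end_near. Qed.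

Lemma jacobi_tension p : half_space_int p ->
  jacobi g h v (tension g h v) p = 0.
Proof.
move=> p0; rewrite /jacobi /rough_laplacian /nabla_adjoint.
rewrite !trace_half_space_metric !big1 ?scaler0 ?oppr0 ?addr0// => i _.
  rewrite dmap_axis_map tension_axis_map// scalerA.
  exact: riemann_collinear.
rewrite /nabla_form (nabla_axis_map _ 0)//; last first.
  by rewrite nabla_tension// scale0r.
rewrite big1 ?subr0 => [|k _]; last by rewrite nabla_tension// scaler0.
rewrite mulr0 mul0r scale0r subr0 /pd.
(* The first covariant derivative vanishes on a neighbourhood of [p], so its own derivative vanishes
   too. *)
rewrite (@near_eq_derive _ _ _ _ (cst 0)) ?derive_cst//.
by near=> q; apply: nabla_tension; near: q; exact: near_half_space_int.
Unshelve. all: by end_near. Qed.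
End AxisMap.

Theorem proposition28 (R : realType) (m n : nat) (a A : R)
    (hm : (1 <= m)%N) (ha : a != 0) (hA : A != 0) :
  let v : 'rV[R]_m.+1 -> 'rV[R]_n.+1 := @axis_map R m n in
  let g := @half_space_metric R m a in
  let h := @half_space_metric R n A in
  [/\ (forall p, half_space p -> half_space (v p)),
      (forall p, half_space_int p -> half_space_int (v p)),
      smooth_on (@half_space_int R m) v,
      biharmonic_on g h v (@half_space_int R m) &
      ~ harmonic_on g h v (@half_space_int R m)].
Proof.
move=> v g h; split.
- by move=> p; rewrite /half_space/= axis_map00.
- by move=> p; rewrite /half_space_int/= axis_map00.
- by rewrite /v axis_mapE; exact: smooth_on_coord0Z.
- by move=> p; exact: jacobi_tension.
(* At a point with x = 1 the X-component of the tension is -m a^2, nonzero by [hm] and [ha]. *)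
move=> /(_ (const_mx 1)) harm.
have p0 : half_space_int (const_mx 1 : 'rV[R]_m.+1).
  by rewrite /half_space_int/= mxE.
have /rowP/(_ 0)/eqP := harm p0.
rewrite tension_axis_map// !mxE eqxx !(mul1r, mulr1) mulf_eq0 oppr_eq0.
by rewrite pnatr_eq0 expf_eq0 (negPf ha) andbF orbF eqn0Ngt hm.
Qed.
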